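(* Let $n\ge2$ and $r>0$. There exists $x\in\mathbb{H}^n$ such that the Cassinian ball $B_{c_{\mathbb{H}^n}}(x,r)$ is not convex.
   Context: $\mathbb{H}^n=\{x=(x_1,\dots,x_n)\in\mathbb{R}^n: x_n>0\}$ is the upper half-space. For a domain $D\subsetneq\mathbb{R}^n$, the Cassinian metric on $D$ is $$c_D(x,y)=\sup_{p\in\partial D}\frac{|x-y|}{|x-p||p-y|},\qquad x,y\in D,$$ where $|\cdot|$ is the Euclidean norm and the supremum is over the finite boundary points of $D$ (the point $\infty$, if it is a boundary point in $\overline{\mathbb{R}^n}$, contributes $0$). The Cassinian ball is $B_{c_D}(x,r)=\{y\in D: c_D(x,y)<r\}$. Convexity is in the usual Euclidean sense. *)

(* Defs.v *)
From mathcomp Require Import all_boot all_order all_algebra.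
From mathcomp Require Import all_classical all_reals all_analysis.

Set Implicit Arguments.
Unset Strict Implicit.
Unset Printing Implicit Defensive.

Import Order.TTheory GRing.Theory Num.Theory.
Import numFieldNormedType.Exports.

Local Open Scope classical_set_scope.
Local Open Scope ring_scope.

(* The library norm `|x| on row vectors is the max norm, so the Euclidean norm
   is defined here; the two induce the same topology on 'rV[R]_n. *)
Definition enorm (R : realType) (n : nat) (x : 'rV[R]_n) : R :=
  Num.sqrt (\sum_(i < n) x ord0 i ^+ 2).

Definition boundary (T : topologicalType) (D : set T) : set T :=
  closure D `\` interior D.

(* For D open, nonempty and different from the whole space, and x, y in D, the
   set below is nonempty and bounded and no denominator vanishes, so the real
   [sup] is the actual supremum (outside of this case it may be a default
   value). *)
Definition cassinian (R : realType) (n : nat) (D : set 'rV[R]_n)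
    (x y : 'rV[R]_n) : R :=
  sup [set enorm (x - y) / (enorm (x - p) * enorm (p - y)) | p in boundary D].

Definition cassinian_ball (R : realType) (n : nat) (D : set 'rV[R]_n)
    (x : 'rV[R]_n) (r : R) : set 'rV[R]_n :=
  [set y | D y /\ cassinian D x y < r].

(* The upper half-space of R^(n+1): [ord_max] indexes the last coordinate. *)
Definition upper_halfspace (R : realType) (n : nat) : set 'rV[R]_n.+1 :=
  [set x | 0 < x ord0 ord_max].
Arguments upper_halfspace : clear implicits.

(* Main.v *)
Require Import Defs.
From mathcomp Require Import all_boot all_order all_algebra.
From mathcomp Require Import all_classical all_reals all_analysis.
From mathcomp Require Import ring lra.

Import Order.TTheory GRing.Theory Num.Theory.
Import numFieldNormedType.Exports.

Local Open Scope classical_set_scope.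
Local Open Scope ring_scope.

(** The ball of centre [x = (0, h)] and radius [3 / h] reaches lower at the
    foot of [x] than far away from it.  Indeed a point [(0, b)] below [x] has
    distance [(h - b) / (h b)], so it enters the ball as soon as [b > h / 4];
    whereas for [(a, b)] with [a] large, the boundary point below it shows that
    the distance is at least about [1 / b], so that [b] has to exceed a number
    close to [h / 3].  On the other hand every horizontal translate [(A, h)] of
    [x] is at distance at most [2 / h], hence in the ball.  The segment from a
    fixed point [(0, b)] with [b] slightly above [h / 4] to [(A, h)] becomes
    nearly horizontal as [A] grows, so it contains points [(a, b')] with [a]
    large and [b'] still below the level required there: it leaves the ball.
    Any radius [r] is reached by choosing [h = 3 / r].

    The concrete choice, in units of [h], is [b = 7/25], [A = 72] and the point
    [(2, 3/10)] of the segment.  Lemmas [cassinian_vertical] and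
    [cassinian_horizontal] place the endpoints in the ball, and [cassinian_foot]
    excludes that point.  These points lie in the plane of the first and last
    coordinates; the boundary points range over the whole hyperplane, but
    bounding the norm from below by a single coordinate suffices for them. *)

(** * Euclidean norm *)

Lemma ler_enorm_coord (R : realType) (n : nat) (x : 'rV[R]_n) (i : 'I_n) :
  `|x ord0 i| <= enorm x.
Proof.
rewrite -sqrtr_sqr /enorm ler_wsqrtr// (bigD1 i)//= lerDl.
by apply: sumr_ge0 => j _; exact: sqr_ge0.
Qed.

Lemma enorm_ge0 (R : realType) (n : nat) (x : 'rV[R]_n) : 0 <= enorm x.
Proof. exact: sqrtr_ge0. Qed.

(** The vector [(a, 0, ..., 0, b)].  In dimension one the two coordinates
    coincide and [b] wins, so that the last coordinate is always [b]. *)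
Definition planar (R : realType) (n : nat) (a b : R) : 'rV[R]_n.+1 :=
  \row_j (if j == ord_max then b else if j == ord0 then a else 0).
Arguments planar {R} n a b.

Lemma planar_last (R : realType) (n : nat) (a b : R) :
  planar n a b ord0 ord_max = b.
Proof. by rewrite mxE eqxx. Qed.

Lemma planar_first (R : realType) (n : nat) (a b : R) : (0 < n)%N ->
  planar n a b ord0 ord0 = a.
Proof.
move=> n0; rewrite mxE eqxx ifF//.
by apply/negbTE; rewrite -val_eqE /= eq_sym -lt0n.
Qed.

Lemma planarB (R : realType) (n : nat) (a b c d : R) :
  planar n a b - planar n c d = planar n (a - c) (b - d).
Proof.
apply/rowP => j; rewrite !mxE.
by case: ifP => // _; case: ifP => //; rewrite subr0.
Qed.

Lemma enorm_planar (R : realType) (n : nat) (a b : R) : (0 < n)%N ->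
  enorm (planar n a b) = Num.sqrt (a ^+ 2 + b ^+ 2).
Proof.
move=> n0.
have n0m : (ord0 : 'I_n.+1) != ord_max.
  by rewrite -val_eqE /= eq_sym -lt0n.
rewrite /enorm (bigD1 ord_max)//= (bigD1 ord0)//= big1 ?addr0.
  by rewrite planar_last planar_first// addrC.
by move=> j /andP[/negbTE jm /negbTE j0]; rewrite mxE jm j0 expr0n.
Qed.

(** * The boundary of the half-space *)

Lemma continuous_last (R : realType) (n : nat) :
  continuous (fun x : 'rV[R]_n.+1 => x ord0 ord_max).
Proof. exact: coord_continuous. Qed.

(** For the second inclusion, a point of the hyperplane is a limit of the
    points vertically above it, and does not lie in the half-space itself. *)
Lemma boundary_upper_halfspace (R : realType) (n : nat) :
  boundary (upper_halfspace R n) = [set p | p ord0 ord_max = 0].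
Proof.
have oH : open (upper_halfspace R n).
  apply: (@open_comp _ _ (fun x : 'rV[R]_n.+1 => x ord0 ord_max)
    [set y | y > 0]); last exact: open_gt.
  by move=> x _; exact: continuous_last.
rewrite /boundary; move/interior_id : oH => ->.
apply/seteqP; split => p /=.
  move=> [clp /negP]; rewrite -leNgt => p0; apply/eqP; rewrite eq_le p0/=.
  have cH : closed [set x : 'rV[R]_n.+1 | 0 <= x ord0 ord_max].
    apply: (@closed_comp _ _ (fun x : 'rV[R]_n.+1 => x ord0 ord_max)
      [set y | 0 <= y]); last exact: closed_ge.
    by move=> x _; exact: continuous_last.
  rewrite closure_id in cH; move: clp.
  suff : closure (upper_halfspace R n) `<=`
      [set x : 'rV[R]_n.+1 | 0 <= x ord0 ord_max] by apply.
  by rewrite [X in _ `<=` X]cH; apply: closureS => x /ltW.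
move=> p0; split; last by rewrite /upper_halfspace /= p0 ltxx.
move=> B Bp.
have cvp : p + t *: planar n 0 1 @[t --> (0 : R)^'+] --> p.
  have -> : nbhs p = nbhs (p + 0 *: planar n 0 1) by rewrite scale0r addr0.
  apply: cvg_at_right_filter.
  by apply: cvgD; [exact: cvg_cst | apply: cvgZr_tmp; exact: cvg_id].
have [t [Bt t0]] : exists t : R, B (p + t *: planar n 0 1) /\ 0 < t.
  apply: (@filter_ex _ ((0 : R)^'+)); apply: filterI; first exact: cvp.
  exact: nbhs_right_gt.
exists (p + t *: planar n 0 1); split => //.
by rewrite /upper_halfspace /= mxE mxE planar_last p0 add0r mulr1.
Qed.

(** * Bounding the Cassinian metric *)

Lemma cassinian_le (R : realType) (n : nat) (D : set 'rV[R]_n)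
    (x y : 'rV[R]_n) (m : R) :
  boundary D !=set0 -> 0 < m ->
  (forall p, boundary D p -> m <= enorm (x - p) * enorm (p - y)) ->
  cassinian D x y <= enorm (x - y) / m.
Proof.
move=> [q Dq] m0 xym; apply: ge_sup.
  by exists (enorm (x - y) / (enorm (x - q) * enorm (q - y))); exists q.
move=> _ [p Dp <-]; have mp := xym p Dp.
by rewrite ler_wpM2l ?enorm_ge0// lef_pV2// posrE (lt_le_trans m0).
Qed.

(** The positive lower bound [m] makes the set of quotients bounded, without
    which its supremum would be a default value. *)
Lemma le_cassinian (R : realType) (n : nat) (D : set 'rV[R]_n)
    (x y : 'rV[R]_n) (m : R) (q : 'rV[R]_n) :
  0 < m ->
  (forall p, boundary D p -> m <= enorm (x - p) * enorm (p - y)) ->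
  boundary D q ->
  enorm (x - y) / (enorm (x - q) * enorm (q - y)) <= cassinian D x y.
Proof.
move=> m0 xym Dq; apply: ub_le_sup; last by exists q.
exists (enorm (x - y) / m) => _ [p Dp <-]; have mp := xym p Dp.
by rewrite ler_wpM2l ?enorm_ge0// lef_pV2// posrE (lt_le_trans m0).
Qed.

Section half_space.
Variables (R : realType) (n : nat).
Implicit Types (x y p : 'rV[R]_n.+1) (h a b : R).
Local Notation H := (upper_halfspace R n).

Lemma boundary_planar a : boundary H (planar n a 0).
Proof. by rewrite boundary_upper_halfspace /= planar_last. Qed.

Lemma enorm_boundaryl x p : boundary H p -> x ord0 ord_max <= enorm (x - p).
Proof.
rewrite boundary_upper_halfspace /= => p0.
apply: le_trans (ler_enorm_coord _ _ _ ord_max).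
by rewrite !mxE p0 subr0 ler_norm.
Qed.

Lemma enorm_boundaryr y p : boundary H p -> y ord0 ord_max <= enorm (p - y).
Proof.
rewrite boundary_upper_halfspace /= => p0.
by apply: le_trans (ler_enorm_coord _ _ _ ord_max);
  rewrite !mxE p0 sub0r normrN ler_norm.
Qed.

Lemma mul_height_le x y p : H x -> H y -> boundary H p ->
  x ord0 ord_max * y ord0 ord_max <= enorm (x - p) * enorm (p - y).
Proof.
rewrite /upper_halfspace /= => x0 y0 Hp.
apply: ler_pM; [exact: ltW|exact: ltW|exact: enorm_boundaryl|].
exact: enorm_boundaryr.
Qed.

(** Every boundary point is at distance at least [h] and [b] from the two
    points, and their common foot shows that the bound is optimal. *)
Lemma cassinian_vertical h b : (0 < n)%N -> 0 < b -> b <= h ->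
  cassinian H (planar n 0 h) (planar n 0 b) <= (h - b) / (h * b).
Proof.
move=> n0 b0 bh; have h0 : 0 < h by exact: lt_le_trans bh.
apply: le_trans (cassinian_le _ _ _ _ _ (h * b) _ _ _) _.
- by exists (planar n 0 0); exact: boundary_planar.
- exact: mulr_gt0.
- move=> p Hp; rewrite -[X in X * _ <= _](planar_last R n 0 h).
  rewrite -[X in _ * X <= _](planar_last R n 0 b).
  by apply: mul_height_le; rewrite /upper_halfspace //= planar_last.
- rewrite planarB enorm_planar// subrr expr0n add0r sqrtr_sqr ger0_norm//.
  by rewrite subr_ge0.
Qed.

(** For each boundary point [p], one of the two distances is at least half of
    the horizontal displacement, and the other at least the common height. *)
Lemma cassinian_horizontal h a : (0 < n)%N -> 0 < h -> 0 < a ->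
  cassinian H (planar n 0 h) (planar n a h) <= 2 / h.
Proof.
move=> n0 h0 a0.
apply: le_trans (cassinian_le _ _ _ _ _ (h * (a / 2)) _ _ _) _.
- by exists (planar n 0 0); exact: boundary_planar.
- by rewrite mulr_gt0// divr_gt0.
- move=> p Hp.
  have := enorm_boundaryl (planar n 0 h) p Hp.
  have := enorm_boundaryr (planar n a h) p Hp.
  rewrite !planar_last => hr hl.
  have firstl : (planar n 0 h - p) ord0 ord0 = - p ord0 ord0.
    by rewrite [LHS]mxE planar_first// mxE add0r.
  have firstr : (p - planar n a h) ord0 ord0 = p ord0 ord0 - a.
    by rewrite [LHS]mxE [X in _ + X]mxE planar_first.
  have [pa|pa] := leP (a / 2) (p ord0 ord0).
    rewrite mulrC; apply: ler_pM => //; [by lra|by lra|].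
    apply: le_trans (ler_enorm_coord _ _ _ ord0).
    by rewrite firstl normrN; apply: le_trans (ler_norm _).
  apply: ler_pM => //; [by lra|by lra|].
  apply: le_trans (ler_enorm_coord _ _ _ ord0).
  by rewrite firstr distrC; apply: le_trans (ler_norm _); lra.
- rewrite planarB enorm_planar// subrr expr0n addr0 sqrtr_sqr.
  rewrite sub0r normrN gtr0_norm//.
  by rewrite le_eqVlt; apply/orP; left; apply/eqP; field; lra.
Qed.

(** The quotient at the boundary point below the second argument. For large
    [a] it is close to [b^-1]. *)
Lemma cassinian_foot h a b : (0 < n)%N -> 0 < h -> 0 < b ->
  Num.sqrt (a ^+ 2 + (h - b) ^+ 2) / (Num.sqrt (a ^+ 2 + h ^+ 2) * b) <=
  cassinian H (planar n 0 h) (planar n a b).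
Proof.
move=> n0 h0 b0.
have := @le_cassinian R n.+1 H (planar n 0 h) (planar n a b) (h * b)
  (planar n a 0) (mulr_gt0 h0 b0) _ (boundary_planar a).
rewrite !planarB !enorm_planar// subrr expr0n subr0 !sub0r !sqrrN add0r.
rewrite (sqrtr_sqr b) gtr0_norm//; apply=> p Hp.
rewrite -[X in X * _ <= _](planar_last R n 0 h).
rewrite -[X in _ * X <= _](planar_last R n a b).
by apply: mul_height_le; rewrite /upper_halfspace //= planar_last.
Qed.

End half_space.

Theorem proposition4p4 (R : realType) (n : nat) (n_ge2 : (2 <= n.+1)%N)
    (r : R) (r_gt0 : 0 < r) :
  exists x : 'rV[R]_n.+1,
    upper_halfspace R n x /\
    ~ convex_set (cassinian_ball (upper_halfspace R n) x r).
Proof.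
have n0 : (0 < n)%N by [].
pose h : R := 3 / r.
have h0 : 0 < h by rewrite divr_gt0.
have rE : r = 3 / h by rewrite /h; field; lra.
clearbody h; subst r.
exists (planar n 0 h); split; first by rewrite /upper_halfspace /= planar_last.
move=> cvx.
have ballP : planar n 0 (7 / 25 * h) \in
    cassinian_ball (upper_halfspace R n) (planar n 0 h) (3 / h).
  rewrite inE; split; first by rewrite /upper_halfspace /= planar_last; lra.
  apply: (le_lt_trans (cassinian_vertical _ _ _ _ n0 _ _)); [lra|lra|].
  have -> : (h - 7 / 25 * h) / (h * (7 / 25 * h)) = (18 / 7) / h by field; lra.
  by rewrite ltr_pM2r ?invr_gt0//; lra.
have ballQ : planar n (72 * h) h \in
    cassinian_ball (upper_halfspace R n) (planar n 0 h) (3 / h).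
  rewrite inE; split; first by rewrite /upper_halfspace /= planar_last.
  apply: (le_lt_trans (cassinian_horizontal _ _ _ _ n0 _ _)); [lra|lra|].
  by rewrite ltr_pM2r ?invr_gt0//; lra.
(* The abscissa 2 h is the fraction 1/36 of 72 h. *)
have l0 : 0 <= 36^-1 :> R by rewrite invr_ge0.
have l1 : 36^-1 <= 1 :> R by rewrite invf_le1// ler1n.
have := cvx _ _ (Itv01 l0 l1) ballQ ballP.
have -> : conv (Itv01 l0 l1)
    (planar n (72 * h) h : convex_lmodType 'rV[R]_n.+1)
    (planar n 0 (7 / 25 * h)) = planar n (2 * h) (3 / 10 * h).
  rewrite /conv /=; apply/rowP => j; rewrite !mxE /= /unstable.onem.
  by case: ifP => _; [field|case: ifP => _; field].
rewrite inE => -[_]; apply/negP; rewrite -leNgt.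
apply: le_trans (cassinian_foot _ _ _ _ _ n0 h0 _); last by lra.
have d0 : 0 < Num.sqrt ((2 * h) ^+ 2 + h ^+ 2) * (3 / 10 * h).
  by apply: mulr_gt0; [rewrite sqrtr_gt0; nra|lra].
rewrite ler_pdivlMr//.
have -> : 3 / h * (Num.sqrt ((2 * h) ^+ 2 + h ^+ 2) * (3 / 10 * h)) =
    9 / 10 * Num.sqrt ((2 * h) ^+ 2 + h ^+ 2) by field; lra.
rewrite -[9 / 10]ger0_norm; last by lra.
rewrite -sqrtr_sqr -sqrtrM ?sqr_ge0// ler_wsqrtr//.
(* In units of h: 2 ^ 2 + (7/10) ^ 2 exceeds (9/10) ^ 2 * (2 ^ 2 + 1). *)
by nra.
Qed.
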